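(* Let $a\in\{1,2\}$ and let $n,k$ be positive integers with $k\le a3^n$. Then $v_3\big(s(a3^n+1,k+1)\big)=v_3\big(s(a3^n,k)\big)$ if $2\mid (k-a)$, and $v_3\big(s(a3^n+1,k+1)\big)\ge v_3\big(s(a3^n,k+1)\big)+n$ if $2\nmid (k-a)$.
   Context: $s(N,K)$ denotes the unsigned Stirling number of the first kind (the number of permutations of $N$ elements with exactly $K$ disjoint cycles). For a nonzero integer $x$, $v_3(x)$ is the exponent of the largest power of $3$ dividing $x$. *)

(* Defs.v *)
From mathcomp Require Import all_boot all_fingroup.

Set Implicit Arguments.
Unset Strict Implicit.
Unset Printing Implicit Defensive.

(* Unsigned Stirling number of the first kind; [porbits s] is the set of all
   cycles of [s], fixed points included. *)
Definition stirling1 (N K : nat) : nat :=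
  #|[set s : 'S_N | #|porbits s| == K]|.

(* Main.v *)
(** With N = a 3^n, s(N, j+1) is the coefficient of x^j in prod_(0 < i < N) (x + i), and the
    substitution Y = 2x + N turns this product, up to a power of 2, into
    F_N(Y) = prod_(0 < i < N) (Y + 2i - N), which is even or odd: F_N(Y) = T_n(Y^2) Y^(a-1).
    The factors with 3 | i form a rescaled copy of F_(N/3); the other ones have a product
    congruent to (Y^2 - 1)^(N/3) modulo 3^n, whose coefficients have known valuations.  Inductively
    this determines the valuation f(m) of every coefficient of T_n, and f(m) < 2n + f(m+1).
    Expanding T_n((2x+N)^2) (2x+N)^(a-1), the estimate makes the lowest term dominate:
    s(N, j+1) has valuation f(m) if j = 2m + a - 1, and valuation at least n + f(m) if
    j + 1 = 2m + a - 1.  Both claims then follow from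
    s(N+1, k+1) = N s(N, k+1) + s(N, k). *)

Require Import Defs.
From mathcomp Require Import all_boot all_order all_algebra all_fingroup.
From mathcomp Require Import zify ring.

Set Implicit Arguments.
Unset Strict Implicit.
Unset Printing Implicit Defensive.

Local Open Scope group_scope.

(** * Cycle counts and the recurrence for Stirling numbers *)

Lemma porbit_lift_perm0 N (s : 'S_N) : porbit (lift_perm ord0 ord0 s) ord0 = [set ord0].
Proof.
apply/setP=> y; rewrite inE; apply/porbitP/eqP => [[i ->]|->]; last by exists 0; rewrite expg0 perm1.
by elim: i => [|i IH]; rewrite ?perm1 // expgSr permM IH lift_perm_id.
Qed.

Lemma porbit_lift_perm_lift N (s : 'S_N) (x : 'I_N) :
  porbit (lift_perm ord0 ord0 s) (lift ord0 x) = lift ord0 @: porbit s x.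
Proof.
have E i : (lift_perm ord0 ord0 s ^+ i) (lift ord0 x) = lift ord0 ((s ^+ i) x).
  by elim: i => [|i IH]; rewrite ?expg0 ?perm1 // !expgSr !permM IH lift_perm_lift.
apply/setP=> y; apply/porbitP/imsetP => [[i ->]|[z /porbitP[i ->] ->]]; last by exists i.
by exists ((s ^+ i) x) => //; apply: mem_porbit.
Qed.

Lemma card_porbits_lift_perm N (s : 'S_N) :
  #|porbits (lift_perm ord0 ord0 s)| = #|porbits s|.+1.
Proof.
have -> : porbits (lift_perm ord0 ord0 s)
          = [set ord0] |: ((fun A : {set 'I_N} => lift ord0 @: A) @: porbits s).
  apply/setP=> A; rewrite in_setU1; apply/imsetP/orP.
    move=> [x _ ->]; case: (unliftP ord0 x) => [y ->|->].
      right; apply/imsetP; exists (porbit s y); first exact: imset_f.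
      exact: porbit_lift_perm_lift.
    by left; rewrite porbit_lift_perm0.
  case=> [/eqP->|/imsetP[B /imsetP[y _ ->] ->]].
    by exists ord0; rewrite ?porbit_lift_perm0.
  by exists (lift ord0 y); rewrite ?porbit_lift_perm_lift.
rewrite cardsU1 card_imset; last exact/imset_inj/lift_inj.
rewrite (_ : _ \notin _) //; apply/imsetP=> -[B _ /setP /(_ ord0)].
rewrite set11 => /esym/imsetP[y _ /eqP].
by rewrite (negPf (neq_lift _ _)).
Qed.

(* Composing with the transposition [(0 j)] inserts the new point [0] into the cycle of [j]. *)
Definition insert_perm N (p : 'I_N.+1 * 'S_N) : 'S_N.+1 :=
  tperm ord0 p.1 * lift_perm ord0 ord0 p.2.

Lemma insert_perm_inj N : injective (@insert_perm N).
Proof.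
move=> [i s] [j t] /= E.
have {}E x : insert_perm (i, s) x = insert_perm (j, t) x by rewrite E.
have Hij : i = j.
  have := E i; rewrite /insert_perm /= !permM tpermR lift_perm_id => Ei.
  have {Ei}: lift_perm ord0 ord0 t (tperm ord0 j i) = lift_perm ord0 ord0 t ord0.
    by rewrite -Ei lift_perm_id.
  by move/perm_inj => Ej; rewrite -[i](tpermK ord0 j) Ej tpermL.
rewrite Hij in E *; congr pair; apply/permP => x; apply: (@lift_inj _ ord0).
have := E (tperm ord0 j (lift ord0 x)); rewrite /insert_perm /= !permM !tpermK.
by rewrite !lift_perm_lift.
Qed.

Lemma insert_perm_bij N : bijective (@insert_perm N).
Proof.
apply: inj_card_bij; first exact: insert_perm_inj.
by rewrite card_prod card_ord !card_Sn factS.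
Qed.

(** The lift has 0 alone in its cycle, so a nontrivial [tperm ord0 j] merges that cycle with the one
    of [j] and undoes the extra cycle; for [j = ord0] nothing is merged. *)
Lemma card_porbits_insert_perm N (j : 'I_N.+1) (s : 'S_N) :
  #|porbits (insert_perm (j, s))| = #|porbits s| + (j == ord0).
Proof.
have := porbits_mul_tperm (lift_perm ord0 ord0 s) ord0 j.
rewrite /insert_perm /= card_porbits_lift_perm porbit_sym porbit_lift_perm0 inE eq_sym.
by case: (ord0 == j) => /=; rewrite ?addn0 ?addn1 ?addn2 // => -[].
Qed.

Lemma stirling1SS N K :
  stirling1 N.+1 K.+1 = N * stirling1 N K.+1 + stirling1 N K.
Proof.
have E : stirling1 N.+1 K.+1
         = \sum_(j < N.+1) #|[set s : 'S_N | #|porbits s| + (j == ord0) == K.+1]|.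
  rewrite /stirling1 -sum1dep_card (reindex _ (onW_bij _ (insert_perm_bij N))) /=.
  under [RHS]eq_bigr do rewrite -sum1dep_card.
  by rewrite pair_big_dep /=; apply: eq_bigl => -[j s]; rewrite card_porbits_insert_perm.
(* The choice [j = ord0] makes 0 a fixed point; the other [N] choices all contribute the same
   count. *)
rewrite E big_ord_recl addnC; congr (_ + _); last first.
  by apply: eq_card => s; rewrite !inE eqxx addn1 eqSS.
rewrite (eq_bigr (fun _ => stirling1 N K.+1)) ?sum_nat_const ?card_ord // => j _.
by apply: eq_card => s; rewrite !inE addn0.
Qed.

Lemma stirling1S0 N : stirling1 N.+1 0 = 0.
Proof.
apply/eqP; rewrite cards_eq0; apply/eqP/setP => s; rewrite !inE cards_eq0.
by apply/negbTE/set0Pn; exists (porbit s ord0); apply: imset_f.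
Qed.

Lemma stirling10 K : stirling1 0 K = (K == 0).
Proof.
rewrite /stirling1; have E (s : 'S_0) : #|porbits s| = 0.
  by apply/eqP; rewrite cards_eq0; apply/eqP/setP => A; rewrite inE; apply/imsetP => -[[]].
rewrite (eq_card (B := [set s : 'S_0 | 0 == K])); last by move=> s; rewrite !inE E.
case: K => [|K] /=; first by rewrite cardsT card_Sn.
by apply/eqP; rewrite cards_eq0; apply/eqP/setP => s; rewrite !inE.
Qed.

Lemma stirling1_small N K : N < K -> stirling1 N K = 0.
Proof.
elim: N K => [|N IH] [|K] // NK; first by rewrite stirling10.
by rewrite stirling1SS !IH ?muln0 // ltnW.
Qed.

Local Close Scope group_scope.
Import GRing.Theory Num.Theory.
Local Open Scope ring_scope.

(** * Rising factorials as generating functions *)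

Lemma coef_rising_factorial N K :
  (\prod_(0 <= i < N) ('X + i%:Z%:P) : {poly int})`_K = (stirling1 N K)%:Z.
Proof.
elim: N K => [|N IH] K; first by rewrite big_geq // coef1 stirling10; case: K.
rewrite big_nat_recr //= mulrDr coefD coefMX coefMC !IH.
case: K => [|K] /=; last by rewrite stirling1SS; lia.
by rewrite add0r stirling1S0; case: N {IH} => [|N]; rewrite ?stirling1S0 ?mul0r ?mulr0.
Qed.

Lemma coef_rising_factorial1 N K :
  (\prod_(1 <= i < N.+1) ('X + i%:Z%:P) : {poly int})`_K = (stirling1 N.+1 K.+1)%:Z.
Proof. by rewrite -coef_rising_factorial [in RHS]big_ltn // polyC0 addr0 coefXM. Qed.

(** * 3-adic valuations of integers *)

Definition has_val (x : int) (m : nat) := (x != 0) && (logn 3 `|x| == m).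

Lemma dvd_exp3P (m : nat) (x : int) : x != 0 ->
  (((3 ^ m)%:Z %| x)%Z = (m <= logn 3 `|x|)%N).
Proof. by move=> x0; rewrite -pfactor_dvdn // absz_gt0. Qed.

Lemma has_valE x m :
  has_val x m = ((3 ^ m)%:Z %| x)%Z && ~~ ((3 ^ m.+1)%:Z %| x)%Z.
Proof.
rewrite /has_val; case: (eqVneq x 0) => [->|x0] /=; first by rewrite !dvdz0.
by rewrite !dvd_exp3P // -leqNgt eqn_leq andbC.
Qed.

Lemma has_val_dvd x m k : has_val x m -> (k <= m)%N -> ((3 ^ k)%:Z %| x)%Z.
Proof. by case/andP=> x0 /eqP <- km; rewrite dvd_exp3P. Qed.

Lemma has_valD x y m : has_val x m -> ((3 ^ m.+1)%:Z %| y)%Z -> has_val (x + y) m.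
Proof.
rewrite !has_valE => /andP[x1 x2] y1.
have y2 : ((3 ^ m)%:Z %| y)%Z by apply: dvdz_trans y1; rewrite dvdzE dvdn_exp2l.
by rewrite !rpredDr ?x1.
Qed.

Lemma has_valM x y m k : has_val x m -> has_val y k -> has_val (x * y) (m + k).
Proof.
move=> /andP[x0 /eqP <-] /andP[y0 /eqP <-]; rewrite /has_val mulf_neq0 //=.
by rewrite abszM lognM ?absz_gt0.
Qed.

Lemma has_val_sum n (F : 'I_n -> int) (i0 : 'I_n) m :
  has_val (F i0) m ->
  (forall i, i != i0 -> ((3 ^ m.+1)%:Z %| F i)%Z) -> has_val (\sum_i F i) m.
Proof.
move=> v0 vi; rewrite (bigD1 i0) //=; apply: has_valD => //.
by apply: rpred_sum => i /vi.
Qed.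

Lemma has_val_exp3 m : has_val (3 ^ m)%:Z m.
Proof. by rewrite /has_val pfactorK //= eqxx andbT eqz_nat expn_eq0. Qed.

Lemma has_val_nat m : (0 < m)%N -> has_val m%:Z (logn 3 m).
Proof. by move=> m0; rewrite /has_val eqxx andbT; lia. Qed.

Lemma has_val_sign k x m : has_val x m -> has_val ((-1) ^+ k * x) m.
Proof. by rewrite /has_val mulf_eq0 signr_eq0 /= abszMsign. Qed.

(** * Valuations of binomial coefficients *)

Section Binomial.
Local Open Scope nat_scope.

Lemma logn_le_pow a n l : a = 1 \/ a = 2 -> 0 < l <= a * 3 ^ n -> logn 3 l <= n.
Proof.
move=> ha /andP[l0 ll]; rewrite -ltnS -(ltn_exp2l _ _ (isT : 1 < 3)).
apply: leq_ltn_trans (dvdn_leq l0 (pfactor_dvdnn 3 l)) _.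
apply: leq_ltn_trans ll _; rewrite expnS ltn_pmul2r ?expn_gt0 //.
by case: ha => ->.
Qed.

Lemma logn_subn_pow a n i : a = 1 \/ a = 2 -> 0 < i < a * 3 ^ n ->
  logn 3 (a * 3 ^ n - i) = logn 3 i.
Proof.
move=> ha /andP[i0 id]; have [m m3 Em] := pfactor_coprime (isT : prime 3) i0.
have vn : logn 3 i <= n by apply: (@logn_le_pow a) => //; rewrite i0 ltnW.
move: (logn 3 i) vn Em id => v vn -> id; rewrite -(subnKC vn) in id *.
rewrite [3 ^ (v + _)]expnD [3 ^ v * _]mulnC mulnA -mulnBl in id *.
rewrite ltn_pmul2r ?expn_gt0 // in id.
rewrite lognM ?subn_gt0 ?expn_gt0 // pfactorK // logn_coprime //.
rewrite !prime_coprime // in m3 *; case: (n - v) id => [|w] id; last first.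
  by rewrite dvdn_subr ?(ltnW id) // expnS mulnCA dvdn_mulr.
(* Here [v = n], and [0 < m < a] leaves only [m = 1], [a = 2]. *)
have m0 : 0 < m by case: m m3 {id}.
by move: id; rewrite expn0 muln1; case: ha m0 => ->; case: m {m3} => [|[]].
Qed.

(** The case [l = 0] is separate: since [logn 3 0] is 0, the general formula would give [n] there
    instead of 0. *)
Definition binom_val n l := if l == 0 then 0 else n - logn 3 l.

Lemma logn_pow_mul a n : a = 1 \/ a = 2 -> logn 3 (a * 3 ^ n) = n.
Proof.
move=> ha; rewrite lognM ?expn_gt0 ?pfactorK //; last by case: ha => ->.
by case: ha => ->.
Qed.

(** With d = a 3^n, passing from C(d, l) to C(d, l+1) multiplies by (d - l)/(l + 1). As d - l and l
    have the same valuation for 0 < l < d, the valuations telescope. *)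
Lemma logn_bin_pow a n l : a = 1 \/ a = 2 -> l <= a * 3 ^ n ->
  logn 3 'C(a * 3 ^ n, l) = binom_val n l.
Proof.
move=> ha; elim: l => [|l IH] ld; first by rewrite bin0 logn1.
have := congr1 (logn 3) (mul_bin_left (a * 3 ^ n) l).
rewrite !lognM ?bin_gt0 ?subn_gt0 // 1?ltnW // IH ?(ltnW ld) //.
have := @logn_le_pow a n l.+1 ha; rewrite ld /binom_val => /(_ isT) l1.
case: l ld IH l1 => [|l] ld IH l1 /=.
  by rewrite subn0 logn_pow_mul // logn1; lia.
rewrite logn_subn_pow //; have := @logn_le_pow a n l.+1 ha; rewrite (ltnW ld) => /(_ isT).
by lia.
Qed.
End Binomial.

(** * Profiles of coefficient valuations *)

(* [f j] is the 3-adic valuation of the coefficient of degree [j] of [T], for [j <= M]; the last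
   three fields confine it to a neighbourhood of the Newton polygon of [T]. *)
Record profile (n M : nat) (T : {poly int}) (f : nat -> nat) : Prop := Profile {
  profile_size : (size T <= M.+1)%N;
  profile_val : forall j, (j <= M)%N -> has_val T`_j (f j);
  profile_lead : f M = 0%N;
  profile_drop : forall j, (j < M)%N -> (f j < 2 * n + f j.+1)%N;
  profile_rise : forall i j, (i < j <= M)%N -> (f j <= f i + n)%N;
  profile_slope : forall s, (0 < s <= M)%N -> (n < f (M - s) + logn 3 s + 2 * s)%N }.

(** If 3^(v(l)+1) divided both s and l + s, it would divide l. The alternative selects the estimate
    to use in [profileM]. *)
Lemma logn3_add l s : (0 < l)%N -> (0 < s)%N ->
  (logn 3 s <= logn 3 l)%N \/ (logn 3 (l + s) <= logn 3 l)%N.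
Proof.
move=> l0 s0; case: (leqP (logn 3 s) (logn 3 l)) => [|ls]; [by left | right].
rewrite leqNgt; apply/negP => lls.
have: (3 ^ (logn 3 l).+1 %| l)%N.
  by rewrite -(dvdn_addl _ (n := s)) pfactor_dvdn // addn_gt0 l0.
by rewrite pfactor_dvdn // ltnn.
Qed.

Lemma profile0 : profile 0 0 1 (fun _ => 0%N).
Proof.
split=> //; first by rewrite size_poly1.
- by case=> // _; rewrite coef1.
- by move=> s /andP[s0]; rewrite leqn0 => /eqP j0; rewrite j0 in s0.
Qed.

(* Multiplying by [U] appends to the Newton polygon of the rescaled [T] a segment of slope 0 and
   length [d]; the binomial valuations of the coefficients of [U] survive on it. *)
Lemma profileM a n M (T U : {poly int}) f d :
  d = (a * 3 ^ n)%N -> a = 1%N \/ a = 2 -> (M < d)%N -> profile n M T f ->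
  (size U <= d.+1)%N -> (forall l, (l <= d)%N -> has_val U`_l (binom_val n l)) ->
  exists f', profile n.+1 (M + d) (\poly_(i < M.+1) ((9 ^ (M - i))%:Z * T`_i) * U) f'.
Proof.
move=> Ed ha Md [sT vT lT dropT riseT slopeT] sU vU.
have lognd l : (0 < l <= d)%N -> (logn 3 l <= n)%N by rewrite Ed; apply: logn_le_pow.
have d3 : (n < d)%N.
  by rewrite Ed; apply: leq_trans (ltn_expl n (isT : (1 < 3)%N)) _; rewrite leq_pmull //; case: ha => ->.
set S := \poly_(i < _) _.
have vS i : (i <= M)%N -> has_val S`_i (2 * (M - i) + f i).
  move=> iM; rewrite coef_poly ltnS iM; apply: has_valM (vT _ iM).
  by rewrite (_ : 9 = 3 ^ 2)%N // -expnM has_val_exp3.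
(* Up to degree [M], the constant coefficient of [U] is a 3-adic unit and the valuation comes from
   [S]; beyond, the leading coefficient of [S] is a unit and the valuation comes from [U]. *)
pose f' j := if (j <= M)%N then (f j + 2 * (M - j))%N else binom_val n (j - M)%N.
have binom_val_le l : (binom_val n l <= n)%N by rewrite /binom_val; case: eqP => // _; lia.
exists f'; split.
- apply: leq_trans (size_mul_leq _ _) _; have : (size S <= M.+1)%N by apply: size_poly.
  by move: (size S) (size U) sU => x y; lia.
- move=> j jMd; rewrite coefM /f'; case: leqP => jM.
    apply: (has_val_sum (i0 := ord_max)) => [|i ij] /=.
      by rewrite subnn addnC -[(_ + f j)%N]addn0; apply: has_valM (vU 0%N _); rewrite ?vS.
    have {}ij : (i < j)%N by have := ltn_ord i; rewrite -val_eqE /= in ij; lia.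
    (* Compared with the term of index j, that of index i < j gains 2(j - i) from the scaling and,
       because f(j) <= f(i) + n, loses at most v(j - i) < j - i. *)
    apply: has_val_dvd (has_valM (vS _ _) (vU _ _)) _; rewrite ?leq_subLR; try lia.
    have lij : (logn 3 (j - i) <= n)%N by apply: lognd; lia.
    have := @ltn_logl 3 (j - i); have := riseT i j; rewrite /binom_val.
    by rewrite (_ : (j - i == 0)%N = false); lia.
  have Mj : (M < j.+1)%N by lia.
  apply: (has_val_sum (i0 := Ordinal Mj)) => [|i ij] /=.
    have := has_valM (vS M (leqnn M)) (vU (j - M)%N _); rewrite lT subnn; apply; lia.
  have [Mi|iM] := ltnP M i.
    by rewrite coef_poly ltnS leqNgt Mi mul0r dvdz0.
  have {}iM : (i < M)%N by rewrite -val_eqE /= in ij; lia.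
  have [dji|jid] := ltnP d (j - i).
    by rewrite [U`__]nth_default ?mulr0 ?dvdz0 // (leq_trans sU).
  apply: has_val_dvd (has_valM (vS _ _) (vU _ _)) _; rewrite ?(ltnW iM) //.
  have ji0 : (0 < j - i)%N by lia.
  have jM0 : (0 < j - M)%N by lia.
  have Mi0 : (0 < M - i)%N by lia.
  (* With l = j - M and s = M - i, the claim is v(l + s) < 2s + f(M - s) + v(l). It is clear if v(l
     + s) <= v(l); otherwise v(s) <= v(l), and [slopeT] with v(l + s) <= n gives it. *)
  have := @logn3_add (j - M) (M - i) jM0 Mi0.
  rewrite (_ : j - M + (M - i) = j - i)%N; last by lia.
  have := slopeT (M - i)%N; rewrite subKn ?(ltnW iM) // Mi0 leq_subr => /(_ isT).
  have := lognd (j - i)%N; rewrite ji0 jid => /(_ isT).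
  have := lognd (j - M)%N; rewrite jM0 /= => /(_ ltac:(lia)).
  rewrite /binom_val !gtn_eqF //.
  by move: (logn _ _) (logn _ _) (logn _ _) => x y z; move: (M - i)%N (f i) Mi0 => u v; clear; lia.
- rewrite /f'; case: leqP => dM; first by lia.
  rewrite addKn /binom_val {2}Ed logn_pow_mul // subnn; by case: eqP.
- move=> j jMd; rewrite /f'; case: (leqP j.+1 M) => jM.
    by rewrite (ltnW jM); have := dropT j jM; lia.
  case: (leqP j M) => jM'; last by have := binom_val_le (j - M)%N; lia.
  by have -> : j = M; [lia | rewrite lT subnn; lia].
- move=> i j /andP[ij jMd]; rewrite /f'; case: (leqP j M) => jM.
    by rewrite (leq_trans (ltnW ij) jM); have := riseT i j; rewrite ij jM => /(_ isT); lia.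
  by have := binom_val_le (j - M)%N; lia.
(* For s < d, v(d - s) = v(s) cancels the term [logn 3 s]; for s >= d, the bound n < d suffices. *)
- move=> s /andP[s0 sMd]; rewrite /f'; case: (leqP (M + d - s) M) => sd; first by lia.
  have {}sd : (s < d)%N by lia.
  have -> : (M + d - s - M = d - s)%N by lia.
  rewrite /binom_val {2}Ed logn_subn_pow -?Ed ?s0 ?sd //.
  by rewrite (_ : (d - s == 0)%N = false); have := lognd s; lia.
Qed.

(** * Centered products and blocks of factors with index prime to 3 *)

Definition centered (N : nat) : {poly int} :=
  \prod_(1 <= i < N) ('X + ((2 * i)%:Z - N%:Z)%:P).

(** For [A = 3 * d] these are the factors of [centered (3 * d)] with index prime to 3; a free [A]
    allows cutting a block into translates of shorter ones. *)
Definition unit_block (d : nat) (A : int) : {poly int} :=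
  \prod_(0 <= i < d) (('X + ((2 * (3 * i + 1))%:Z - A)%:P)
                        * ('X + ((2 * (3 * i + 2))%:Z - A)%:P)).

Lemma comp_poly_shift (p : {poly int}) (c : {poly int}) :
  exists q, p \Po ('X + c) = p + c * p^`() + c ^+ 2 * q.
Proof.
elim/poly_ind: p => [|p b [q IH]].
  by exists 0; rewrite comp_poly0 deriv0 !mulr0 !addr0.
exists (p^`() + q * ('X + c)); rewrite comp_poly_MXaddC IH derivMXaddC; ring.
Qed.

Lemma unit_blockD m n A :
  unit_block (m + n) A = unit_block m A * unit_block n (A - (6 * m)%:Z).
Proof.
rewrite /unit_block (@big_cat_nat _ _ _ m) ?leq_addr //=; congr (_ * _).
rewrite -{1}[m]add0n big_addn addKn; apply: eq_bigr => i _.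
by congr (('X + _%:P) * ('X + _%:P)); lia.
Qed.

Lemma unit_block_shift d A (c : int) :
  unit_block d (A - c) = unit_block d A \Po ('X + c%:P).
Proof.
rewrite /unit_block rmorph_prod; apply: eq_bigr => i _.
rewrite /= comp_polyM !comp_polyD !comp_polyX !comp_polyC -!addrA -!polyCD.
by congr (('X + _%:P) * ('X + _%:P)); lia.
Qed.

(** Modulo 3, a single pair of factors is (X + 1)(X + 2) = X^2 - 1. Tripling the length multiplies G
    by its translates by 6 * 3^r and 12 * 3^r; the first-order terms add up to 18 * 3^r * G^2 * G',
    so modulo 3^(r+2) only G^3 is left, and cubing improves the congruence by one power of 3. *)
Lemma unit_block_pow3 r (A : int) : (3 %| A)%Z ->
  exists q, unit_block (3 ^ r) A = ('X^2 - 1) ^+ (3 ^ r) + ((3 ^ r.+1)%:Z)%:P * q.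
Proof.
move=> /dvdzP[B ->] {A}; elim: r B => [|r IH] B.
  exists (2 * 'X + 3 - 2 * B%:P * 'X - 6 * B%:P + 3 * B%:P ^+ 2).
  rewrite /unit_block big_nat1 /= expr1.
  rewrite (_ : (2 * 1)%:Z - B * 3 = 2 - B * 3) // (_ : (2 * 2)%:Z - B * 3 = 4 - B * 3) //.
  rewrite !polyCB !polyCM (_ : (3 ^ 1)%N = 3)%N //.
  rewrite -[3%:Z]/(3%:R : int) !polyC_natr; ring.
have [g Eg] := IH B; set W := 'X^2 - 1 in Eg *.
have [q1 E1] := comp_poly_shift (unit_block (3 ^ r) (B * 3)) (6 * (3 ^ r)%:Z%:P).
have [q2 E2] := comp_poly_shift (unit_block (3 ^ r) (B * 3)) (12 * (3 ^ r)%:Z%:P).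
set c := (3 ^ r)%:Z%:P in E1 E2.
have c3 : (3 ^ r.+1)%:Z%:P = 3 * c.
  by rewrite expnS PoszM polyCM -[3%:Z]/(3%:R : int) polyC_natr.
have c9 : (3 ^ r.+2)%:Z%:P = 9 * c.
  by rewrite !expnS mulnA PoszM polyCM -[(3 * 3)%:Z]/(9%:R : int) polyC_natr.
rewrite c3 in Eg; rewrite c9; set G := unit_block _ _ in E1 E2 Eg; set D := G^`() in E1 E2.
have -> : unit_block (3 ^ r.+1) (B * 3) =
    G * (G + 6 * c * D + (6 * c) ^+ 2 * q1) * (G + 12 * c * D + (12 * c) ^+ 2 * q2).
  rewrite (_ : 3 ^ r.+1 = 3 ^ r + 3 ^ r + 3 ^ r)%N; last by rewrite expnS; lia.
  rewrite !unit_blockD !unit_block_shift -/G -E1 -E2.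
  have c6 : (6 * 3 ^ r)%:Z%:P = 6 * c.
    by rewrite PoszM polyCM -[6%:Z]/(6%:R : int) polyC_natr.
  have c12 : (6 * (3 ^ r + 3 ^ r))%:Z%:P = 12 * c.
    by rewrite addnn -muln2 mulnCA mulnC PoszM polyCM -[(6 * 2)%:Z]/(12%:R : int) polyC_natr.
  by rewrite c6 c12.
(* The witness collects, divided by 9c, the terms other than the leading cube in (W^(3^r) + 3cg)^3
   and then the Taylor terms. *)
exists (W ^+ (3 ^ r) ^+ 2 * g + 3 * c * W ^+ (3 ^ r) * g ^+ 2 + 3 * c ^+ 2 * g ^+ 3
  + (2 * G ^+ 2 * D + G ^+ 2 * (16 * q2 + 4 * q1) * c
     + 8 * G * c * (D + 6 * c * q1) * (D + 12 * c * q2))).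
rewrite expnSr exprM; move: (W ^+ _) Eg => V Eg.
by rewrite Eg; ring.
Qed.

Lemma unit_block_pow a r (A : int) : a = 1%N \/ a = 2 -> (3 %| A)%Z ->
  exists q, unit_block (a * 3 ^ r) A
            = ('X^2 - 1) ^+ (a * 3 ^ r) + ((3 ^ r.+1)%:Z)%:P * q.
Proof.
move=> [] -> A3; first by rewrite mul1n; apply: unit_block_pow3.
have [q1 E1] := unit_block_pow3 r A3.
have A3' : (3 %| A - (6 * 3 ^ r)%:Z)%Z.
  by rewrite rpredB // dvdzE /= dvdn_mulr.
have [q2 E2] := unit_block_pow3 r A3'.
exists (q1 * ('X^2 - 1) ^+ (3 ^ r) + ('X^2 - 1) ^+ (3 ^ r) * q2
        + ((3 ^ r.+1)%:Z)%:P * q1 * q2).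
by rewrite mul2n -addnn unit_blockD E1 E2 exprD; ring.
Qed.

(** The reflection of i to d - 1 - i pairs the index 3i + 1 with 3(d - 1 - i) + 2, their sum being
    3d. Under X -> -X each factor becomes the opposite of its partner, and the signs cancel in
    pairs. *)
Lemma unit_block_even d : unit_block d (3 * d)%:Z \Po - 'X = unit_block d (3 * d)%:Z.
Proof.
rewrite /unit_block rmorph_prod [RHS]big_nat_rev; apply: eq_big_nat => i /= id.
rewrite /= comp_polyM !comp_polyD !comp_polyX !comp_polyC.
set u1 := _%:P; set u2 := _%:P; set v1 := _%:P; set v2 := _%:P.
have -> : v1 = - u2 by rewrite -polyCN; congr (_%:P); lia.
have -> : v2 = - u1 by rewrite -polyCN; congr (_%:P); lia.
ring.
Qed.

Lemma even_poly_comp_sqr (p : {poly int}) :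
  p \Po - 'X = p -> p = even_poly p \Po 'X^2.
Proof.
move=> pN; have Ep := poly_even_odd p.
set E := even_poly p \Po _ in Ep *; set O := _ * 'X in Ep.
have EN : E - O = p.
  rewrite -pN -Ep comp_polyD /E /O comp_polyM comp_polyX -!comp_polyA.
  by rewrite comp_Xn_poly sqrrN mulrN.
apply/polyP => i; move/(congr1 (coefp i)): EN; move/(congr1 (coefp i)): Ep.
by rewrite /= coefD coefB => <-; move: E`_i O`_i => x y; lia.
Qed.

(** * Coefficient valuations of a block *)

Lemma coef_linear_exp (b c : int) d l :
  ((b%:P * 'X + c%:P) ^+ d)`_l = b ^+ l * c ^+ (d - l) * 'C(d, l)%:Z.
Proof.
have E i : ((c%:P ^+ (d - i) * (b%:P * 'X) ^+ i) *+ 'C(d, i))`_l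
           = c ^+ (d - i) * (b ^+ i * (l == i)%:R) *+ 'C(d, i).
  by rewrite exprMn -!rmorphXn /= coefMn !coefCM coefXn.
rewrite addrC exprDn coef_sum; under eq_bigr do rewrite E.
have [ld|dl] := ltnP l d.+1; last first.
  rewrite bin_small // mulr0 big1 // => i _.
  by rewrite gtn_eqF ?mulr0 ?mul0rn // (leq_trans (ltn_ord i)).
rewrite (bigD1 (Ordinal ld)) //= big1 => [|i il].
  by rewrite addr0 eqxx mulr1 -mulr_natr natz; ring.
by rewrite eq_sym -val_eqE /= in il; rewrite (negPf il) !mulr0 mul0rn.
Qed.

Lemma coef_comp_scale (p : {poly int}) (c : int) i :
  (p \Po (c%:P * 'X))`_i = c ^+ i * p`_i.
Proof.
rewrite coef_comp_poly.
have E k : (((c%:P * 'X) ^+ k)`_i) = c ^+ k * (i == k)%:R.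
  by rewrite exprMn -rmorphXn /= coefCM coefXn.
under eq_bigr do rewrite E; have [ip|pi] := ltnP i (size p); last first.
  rewrite nth_default // mulr0 big1 // => k _.
  by rewrite gtn_eqF ?mulr0 // (leq_trans (ltn_ord k)).
rewrite (bigD1 (Ordinal ip)) //= big1 => [|k kl].
  by rewrite addr0 eqxx mulr1 mulrC.
by rewrite eq_sym -val_eqE /= in kl; rewrite (negPf kl) !mulr0.
Qed.

(** By [unit_block_pow] the coefficient is C(d, l) up to sign modulo 3^(n+1), and C(d, l) has
    valuation at most n, so the congruence determines the valuation. *)
Lemma unit_block_val a n l (d := (a * 3 ^ n)%N) : a = 1%N \/ a = 2 -> (l <= d)%N ->
  has_val (even_poly (unit_block d (3 * d)%:Z))`_l (binom_val n l).
Proof.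
move=> ha ld; have [q ->] := unit_block_pow n ha (dvdz_mulr (d%:Z) (dvdzz 3)).
rewrite coef_even_poly coefD coefCM.
have -> : (('X^2 - 1) ^+ d)`_l.*2 = (-1) ^+ (d - l) * 'C(d, l)%:Z :> int.
  have -> : ('X^2 - 1) ^+ d = ((1%:P * 'X + (- 1)%:P) ^+ d) \Po 'X^2 :> {poly int}.
    by rewrite mul1r polyCN rmorphXn /= comp_polyB comp_polyX comp_polyC.
  rewrite coef_comp_poly_Xn // -muln2 dvdn_mull // mulnK //.
  by rewrite coef_linear_exp expr1n mul1r.
apply: has_valD; first by apply: has_val_sign; rewrite -(logn_bin_pow ha ld) has_val_nat // bin_gt0.
apply: dvdz_mulr; rewrite dvdzE /= dvdn_exp2l // /binom_val.
by case: eqP => // _; rewrite ltnS leq_subr.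
Qed.

Lemma size_even_unit_block d A : (size (even_poly (unit_block d A)) <= d.+1)%N.
Proof.
apply: leq_trans (size_even_poly _) _; rewrite leq_uphalf_double doubleS; apply: leqW.
rewrite /unit_block; elim: d => [|d IH]; first by rewrite big_geq // size_poly1.
rewrite big_nat_recr //=; apply: leq_trans (size_mul_leq _ _) _.
have := size_mul_leq ('X + ((2 * (3 * d + 1))%:Z - A)%:P) ('X + ((2 * (3 * d + 2))%:Z - A)%:P).
rewrite !size_XaddC /=; by move: (size _) (size _) IH => x y; lia.
Qed.

(** * The inductive step from d to 3d *)

Lemma big_nat_split3 (R : comNzRingType) (g : nat -> R) d :
  \prod_(1 <= i < 3 * d.+1) g i
  = (\prod_(1 <= i < d.+1) g (3 * i)%N)
    * \prod_(0 <= i < d.+1) (g (3 * i + 1)%N * g (3 * i + 2)%N).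
Proof.
elim: d => [|d IH]; first by rewrite muln1 big_nat1 [X in _ = X * _]big_geq // mul1r big_nat_recr //= big_nat1.
rewrite (_ : 3 * d.+2 = (3 * d.+1).+3)%N; last by lia.
have -> : \prod_(1 <= i < (3 * d.+1).+3) g i = \prod_(1 <= i < 3 * d.+1) g i
            * g (3 * d.+1)%N * g (3 * d.+1).+1 * g (3 * d.+1).+2.
  by rewrite big_nat_recr // big_nat_recr // big_nat_recr ?muln_gt0.
rewrite IH [in RHS]big_nat_recr //= [\prod_(0 <= i < d.+2) _]big_nat_recr //=.
by rewrite addn1 addn2; ring.
Qed.

Lemma centered_mul3 d : (0 < d)%N ->
  centered (3 * d) = (\prod_(1 <= i < d) ('X + (3 * ((2 * i)%:Z - d%:Z))%:P))
                     * unit_block d (3 * d)%:Z.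
Proof.
case: d => // d _; rewrite /centered big_nat_split3; congr (_ * _).
by apply: eq_bigr => i _; congr ('X + _%:P); lia.
Qed.

(** Scaling the roots by 3 scales those of T, a polynomial in X^2, by 9. To avoid division, both
    sides are compared after the injective substitution X -> 3X, where each becomes 3^(2M+e) times
    [centered d]. *)
Lemma scale_roots_even M e d (T : {poly int}) :
  (2 * M + e).+1 = d -> (size T <= M.+1)%N ->
  centered d = (T \Po 'X^2) * 'X^e ->
  \prod_(1 <= i < d) ('X + (3 * ((2 * i)%:Z - d%:Z))%:P)
  = ((\poly_(i < M.+1) ((9 ^ (M - i))%:Z * T`_i)) \Po 'X^2) * 'X^e.
Proof.
move=> Ed sT cT; set S := \poly_(i < _) _.
have ES : S \Po (9%:P * 'X) = (9 ^+ M)%:P * T.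
  apply/polyP => i; rewrite coef_comp_scale coefCM coef_poly.
  case: ltnP => [iM|Mi]; last by rewrite nth_default ?mulr0 // (leq_trans sT).
  rewrite mulrA; congr (_ * _); rewrite -(subnKC (iM : (i <= M)%N)) exprD addKn.
  by rewrite -[(9 ^ _)%:Z]natz natrX.
apply/eqP; rewrite -subr_eq0 -(@comp_poly2_eq0 _ _ (3%:P * 'X)); last first.
  by rewrite mul_polyC size_scale ?size_polyX.
rewrite comp_polyB subr_eq0; apply/eqP.
have -> : (\prod_(1 <= i < d) ('X + (3 * ((2 * i)%:Z - d%:Z))%:P)) \Po (3%:P * 'X)
          = (3 ^+ (2 * M + e))%:P * centered d.
  rewrite rmorph_prod (eq_bigr (fun i => 3%:P * ('X + ((2 * i)%:Z - d%:Z)%:P))) => [|i _].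
    by rewrite big_split prodr_const_nat -Ed subn1 /= rmorphXn.
  by rewrite /= comp_polyD comp_polyX comp_polyC polyCM mulrDr.
rewrite comp_polyM comp_Xn_poly -comp_polyA comp_Xn_poly exprMn -polyC_exp cT.
have -> : (3 ^+ 2)%:P * 'X^2 = (9%:P * 'X) \Po 'X^2 :> {poly int}.
  by rewrite comp_polyM comp_polyX comp_polyC.
rewrite comp_polyA ES comp_polyM comp_polyC exprMn -polyC_exp exprD exprM polyCM.
by rewrite mulrACA.
Qed.

Lemma has_valX x m k : has_val x m -> has_val (x ^+ k) (m * k).
Proof.
move=> xm; elim: k => [|k IH]; first by rewrite muln0.
by rewrite exprS mulnS; apply: has_valM.
Qed.

Lemma centered_profile a n : a = 1%N \/ a = 2 ->
  exists M T f, [/\ (2 * M + a.-1).+1 = (a * 3 ^ n)%N, profile n M T f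
                  & centered (a * 3 ^ n) = (T \Po 'X^2) * 'X^(a.-1)].
Proof.
move=> ha; elim: n => [|n [M [T [f [EM pT cT]]]]].
  (* For n = 0 the centered product is 1 or X. *)
  exists 0%N, 1, (fun _ => 0%N); split; [by case: ha => -> | exact: profile0 |].
  rewrite rmorph1 mul1r /centered.
  by case: ha => ->; [rewrite big_geq | rewrite big_nat1 addr0].
set d := (a * 3 ^ n)%N in EM cT.
have d0 : (0 < d)%N by rewrite -EM.
have Md : (M < d)%N by lia.
have [f' pf'] := profileM (erefl d) ha Md pT (size_even_unit_block d (3 * d)%:Z)
                          (fun l => @unit_block_val a n l ha).
have Ed : (a * 3 ^ n.+1)%N = (3 * d)%N by rewrite expnS mulnCA.
set S := \poly_(i < _) _ in pf'; set U := even_poly _ in pf'.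
exists (M + d)%N, (S * U), f'; split; [by rewrite Ed; lia | exact: pf' |].
rewrite Ed centered_mul3 // (scale_roots_even EM (profile_size pT) cT).
by rewrite (even_poly_comp_sqr (unit_block_even d)) -/S -/U comp_polyM; ring.
Qed.

(** * From centered products back to Stirling numbers *)

Lemma centered_comp N : centered N \Po (2%:P * 'X + N%:Z%:P)
  = (2 ^+ N.-1)%:P * \prod_(1 <= i < N) ('X + i%:Z%:P).
Proof.
rewrite /centered rmorph_prod [LHS](eq_bigr (fun i => 2%:P * ('X + i%:Z%:P))) => [|i _].
  by rewrite big_split prodr_const_nat subn1 polyC_exp.
rewrite /= comp_polyD comp_polyX comp_polyC mulrDr -addrA -!polyCD -polyCM.
by congr (_ + _%:P); lia.
Qed.

Lemma profile_drop_iter n M T f i j :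
  profile n M T f -> (i < j <= M)%N -> (f i < f j + 2 * n * (j - i))%N.
Proof.
move=> pT; elim: j => [|j IH] // /andP[ij jM].
have dj := profile_drop pT jM; case: (ltnP i j) => [ij'|ji].
  have := IH; rewrite ij' ltnW // => /(_ isT); rewrite subSn // mulnS; lia.
by have -> : i = j; [lia | rewrite subSn // subnn muln1; lia].
Qed.

Lemma coprimez_pow32 m k : coprimez (3 ^ m)%:Z (2 ^+ k).
Proof.
by rewrite -[(3 ^ m)%:Z]natz natrX; apply: coprimezXl; apply: coprimezXr.
Qed.

Section StirlingValuation.
Variables (a n M : nat) (T : {poly int}) (f : nat -> nat).
Let N := (a * 3 ^ n)%N.
Let e := a.-1.
Hypothesis ha : a = 1%N \/ a = 2.
Hypothesis EM : (2 * M + e).+1 = N.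
Hypothesis pT : profile n M T f.
Hypothesis cT : centered N = (T \Po 'X^2) * 'X^e.

(** This is the coefficient of X^j in T_m (2X + N)^(2m+e). For j > 2m + e the binomial coefficient
    is 0, so the truncated exponent is harmless. *)
Let term j m : int :=
  T`_m * (2 ^+ j * N%:Z ^+ (2 * m + e - j) * 'C(2 * m + e, j)%:Z).

Lemma stirling1_centered j :
  2 ^+ N.-1 * (stirling1 N j.+1)%:Z = \sum_(m < M.+1) term j m.
Proof.
have N0 : (0 < N)%N by rewrite -EM.
have sT : size T = M.+1.
  apply/anti_leq; rewrite (profile_size pT) ltnNge; apply/negP => sM.
  by have /andP[] := profile_val pT (leqnn M); rewrite nth_default ?eqxx.
rewrite -{2}(prednK N0) -coef_rising_factorial1 prednK // -coefCM -centered_comp cT.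
rewrite comp_polyM comp_Xn_poly -comp_polyA comp_Xn_poly comp_polyE sT mulr_suml coef_sum.
apply: eq_bigr => m _; rewrite -scalerAl coefZ -exprM -exprD.
by rewrite coef_linear_exp.
Qed.

Let val_N : has_val N%:Z n.
Proof. by rewrite -(logn_pow_mul n ha) has_val_nat // -EM. Qed.

Lemma dvd_term k j m : (m <= M)%N ->
  ((2 * m + e >= j)%N -> (k <= f m + n * (2 * m + e - j))%N) -> ((3 ^ k)%:Z %| term j m)%Z.
Proof.
move=> mM kle; rewrite /term; have [jm|mj] := leqP j (2 * m + e); last first.
  by rewrite bin_small // !mulr0 dvdz0.
set p := (_ + e - j)%N in kle *.
have -> : T`_m * (2 ^+ j * N%:Z ^+ p * 'C(2 * m + e, j)%:Z)
          = (T`_m * N%:Z ^+ p) * (2 ^+ j * 'C(2 * m + e, j)%:Z) by ring.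
apply: dvdz_mulr.
exact: has_val_dvd (has_valM (profile_val pT mM) (has_valX _ val_N)) (kle jm).
Qed.

Let val_2X k : has_val (2 ^+ k) 0.
Proof. by rewrite -(mul0n k); apply: has_valX. Qed.

(** The power of 2 is prime to 3. For j = 2m + e, the terms of index below m vanish, index m gives
    2^j T_m, and an index i > m gives valuation at least f(i) + 2n(i - m) > f(m). *)
Lemma stirling1_val m : (m <= M)%N ->
  has_val (stirling1 N (2 * m + e).+1)%:Z (f m).
Proof.
move=> mM; suff: has_val (2 ^+ N.-1 * (stirling1 N (2 * m + e).+1)%:Z) (f m).
  by rewrite !has_valE !Gauss_dvdzr // coprimez_pow32.
rewrite stirling1_centered; have mM' : (m < M.+1)%N by [].
apply: (has_val_sum (i0 := Ordinal mM')) => [|i im] /=.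
  rewrite /term subnn binn expr0 !mulr1 -[f m]addn0.
  exact: has_valM (profile_val pT mM) (val_2X _).
have iM : (i <= M)%N by rewrite -ltnS ltn_ord.
apply: dvd_term => // mi; rewrite -val_eqE /= in im.
have mi' : (m < i)%N by lia.
have := @profile_drop_iter n M T f m i pT; rewrite mi' iM => /(_ isT).
have -> : (n * (2 * i + e - (2 * m + e)) = 2 * n * (i - m))%N by nia.
by [].
Qed.

(** For j = 2m + e - 1 the lowest surviving index is still m, now with one factor N, hence n + f(m);
    an index i > m carries N^(2(i-m)+1), which outweighs the drop from f(m) to f(i). *)
Lemma stirling1_dvd m j : (m <= M)%N -> j.+1 = (2 * m + e)%N ->
  ((3 ^ (n + f m))%:Z %| (stirling1 N j.+1)%:Z)%Z.
Proof.
move=> mM jm; rewrite -(@Gauss_dvdzr _ (2 ^+ N.-1)); last exact: coprimez_pow32.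
rewrite stirling1_centered; apply: rpred_sum => i _.
have iM : (i <= M)%N by rewrite -ltnS ltn_ord.
apply: dvd_term => // ji; case: (ltnP m i) => mi.
  have := @profile_drop_iter n M T f m i pT; rewrite mi iM => /(_ isT).
  have -> : (n * (2 * i + e - j) = 2 * n * (i - m) + n)%N by nia.
  lia.
have -> : (i : nat) = m by lia.
have -> : (2 * m + e - j = 1)%N by lia.
by rewrite muln1 addnC.
Qed.
End StirlingValuation.

(* Both parities through the recurrence *)
Local Close Scope ring_scope.
Theorem theorem1p3 (a n k : nat)
    (ha : a = 1 \/ a = 2) (hn : 0 < n) (hk : 0 < k) (hkN : k <= a * 3 ^ n) :
  ((2 %| (k%:Z - a%:Z)%R)%Z ->
     logn 3 (stirling1 (a * 3 ^ n + 1) (k + 1))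
       = logn 3 (stirling1 (a * 3 ^ n) k))
  /\
  (~~ (2 %| (k%:Z - a%:Z)%R)%Z ->
     logn 3 (stirling1 (a * 3 ^ n) (k + 1)) + n
       <= logn 3 (stirling1 (a * 3 ^ n + 1) (k + 1))).
Proof.
have [M [T [f [EM pT cT]]]] := centered_profile n ha.
have val_s := stirling1_val ha EM pT cT; have dvd_s := stirling1_dvd ha EM pT cT.
have val_N : has_val (a * 3 ^ n)%:Z n.
  by rewrite -{2}(logn_pow_mul n ha) has_val_nat // -EM.
set N := a * 3 ^ n in hkN EM val_s dvd_s val_N *.
have logn_val s m : has_val s%:Z m -> logn 3 s = m by case/andP=> _ /eqP.
rewrite !addn1 stirling1SS; case: k hk hkN => // k _ kN; split=> kp.
  have [m Ek] : exists m, k = 2 * m + a.-1.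
    exists ((k - a.-1) %/ 2); case: ha kp EM => ->; lia.
  have mM : m <= M by lia.
  have vk : has_val (stirling1 N k.+1)%:Z (f m) by rewrite Ek; apply: val_s.
  rewrite (logn_val _ _ vk); apply: logn_val; rewrite addnC PoszD; apply: has_valD vk _.
  (* For m = M the first summand vanishes, as s(N, N+1) = 0. For m < M its valuation is at least 2n
     + f(m+1): one n comes from N, the other from [stirling1_dvd]. *)
  have [mM'|Mm] := ltnP m M; last first.
    by rewrite stirling1_small ?muln0 ?dvdz0 //; lia.
  have dk : ((3 ^ (n + f m.+1))%:Z %| (stirling1 N k.+2)%:Z)%Z by apply: dvd_s => //; lia.
  have := dvdz_mul (has_val_dvd val_N (leqnn n)) dk.
  rewrite -!PoszM -expnD; apply: dvdz_trans; rewrite dvdzE /= dvdn_exp2l //.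
  by have := profile_drop pT mM'; lia.
have [m Ek] : exists m, k.+1 = 2 * m + a.-1.
  exists ((k.+1 - a.-1) %/ 2); case: ha kp EM => ->; lia.
have mM : m <= M by lia.
have vk : has_val (stirling1 N k.+2)%:Z (f m) by rewrite Ek; apply: val_s.
have dk : ((3 ^ (n + f m))%:Z %| (stirling1 N k.+1)%:Z)%Z by apply: dvd_s.
have s0 : 0 < stirling1 N k.+2 by case/andP: vk; lia.
(* Positivity lets [logn] be read as divisibility by 3^(n+f(m)), which both summands satisfy. *)
have s1 : 0 < N * stirling1 N k.+2 + stirling1 N k.+1.
  by rewrite addn_gt0 muln_gt0 s0 -EM.
rewrite (logn_val _ _ vk) addnC -pfactor_dvdn //.
rewrite dvdn_add //; have := dvdz_mul (has_val_dvd val_N (leqnn n)) (has_val_dvd vk (leqnn _)).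
by rewrite -!PoszM -expnD.
Qed.
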